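(* (Confluence lemma) Let $\Lambda$ be a row-finite $k$-graph without sources. Let $\alpha,\beta\in\mathbb{F}_\Lambda\setminus\{0\}$. Then $\alpha\sim\beta$ if and only if there exists $\gamma\in\mathbb{F}_\Lambda\setminus\{0\}$ such that $\alpha\longrightarrow\gamma$ and $\beta\longrightarrow\gamma$.
   Context: **$k$-graphs.** $\mathbb{N}=\{0,1,2,\dots\}$, $k\ge 1$, $e_i$ is the $i$-th standard generator of $\mathbb{N}^k$. A $k$-graph is a countable small category $\Lambda$ with object set $\Lambda^0$ (identified with the identity morphisms), range and source maps $r,s:\Lambda\to\Lambda^0$, and a functor $d:\Lambda\to\mathbb{N}^k$ with the unique factorization property: if $d(\lambda)=m+n$ there are unique $\mu_1,\mu_2\in\Lambda$ with $\lambda=\mu_1\mu_2$, $d(\mu_1)=m$, $d(\mu_2)=n$ (the product $\mu_1\mu_2$ is defined iff $s(\mu_1)=r(\mu_2)$). $v\Lambda^n=\{\lambda: r(\lambda)=v, d(\lambda)=n\}$. $\Lambda$ is row-finite if every $v\Lambda^n$ is finite, and has no sources if every $v\Lambda^n$ is nonempty. **Relations.** $\mathbb{F}_\Lambda=\mathbb{N}\Lambda^0$ is the free commutative monoid on $\Lambda^0$. For $i\in\{1,\dots,k\}$ define $\longrightarrow_i$ on $\mathbb{F}_\Lambda\setminus\{0\}$ by: for vertices $x_1,\dots,x_m$ (repetitions allowed) and $t\in\{1,\dots,m\}$ with $x_t\Lambda^{e_i}\ne\emptyset$, $\sum_{j=1}^m x_j\longrightarrow_i\sum_{j\ne t}x_j+\sum_{\lambda\in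 x_t\Lambda^{e_i}}s(\lambda)$. The relation $\longrightarrow$ on $\mathbb{F}_\Lambda\setminus\{0\}$ is the reflexive and transitive closure of the union of $\longrightarrow_1,\dots,\longrightarrow_k$. $\sim$ is the congruence on $\mathbb{F}_\Lambda$ generated by the relation $\longrightarrow$ (it satisfies $x\sim 0$ only for $x=0$). *)

(* Defs.v *)
From HB Require Import structures.
From mathcomp Require Import all_boot all_order all_algebra.
From mathcomp Require Import finmap multiset.
From mathcomp Require Import all_classical.
From Stdlib Require Import Relations.

Set Implicit Arguments.
Unset Strict Implicit.
Unset Printing Implicit Defensive.

Import GRing.Theory.

Local Open Scope classical_set_scope.
Local Open Scope ring_scope.

(* Degrees are elements of N^k, i.e. of the commutative monoid
   {ffun 'I_k -> nat} under pointwise addition. *)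
Definition degree (k : nat) := {ffun 'I_k -> nat}.

Definition std_gen (k : nat) (i : 'I_k) : degree k :=
  [ffun j => nat_of_bool (j == i)].

(* Countability of the category is carried by the countType structure on
   morphisms and objects. Composition is a total function whose value [comp m n]
   is meaningful only for composable pairs, s m = r n; it is unconstrained
   on all other pairs, and every law below is guarded accordingly. *)
Record kgraph (k : nat) := KGraph {
  obj : countType;
  mor : countType;
  rng : mor -> obj;
  src : mor -> obj;
  idm : obj -> mor;
  comp : mor -> mor -> mor;
  deg : mor -> degree k;
  rng_id : forall v, rng (idm v) = v;
  src_id : forall v, src (idm v) = v;
  rng_comp : forall m n, src m = rng n -> rng (comp m n) = rng m;
  src_comp : forall m n, src m = rng n -> src (comp m n) = src n;
  comp_idl : forall m, comp (idm (rng m)) m = m;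
  comp_idr : forall m, comp m (idm (src m)) = m;
  compA : forall m n p, src m = rng n -> src n = rng p ->
    comp m (comp n p) = comp (comp m n) p;
  deg_id : forall v, deg (idm v) = 0;
  deg_comp : forall m n, src m = rng n -> deg (comp m n) = deg m + deg n;
  unique_factorization : forall (l : mor) (m n : degree k), deg l = m + n ->
    exists! mu : mor * mor,
      [/\ src mu.1 = rng mu.2, l = comp mu.1 mu.2,
          deg mu.1 = m & deg mu.2 = n]
}.

Section KGraphs.
Variables (k : nat) (L : kgraph k).

Definition paths_from (v : obj L) (n : degree k) : set (mor L) :=
  [set l | rng l = v /\ deg l = n].

Definition row_finite : Prop :=
  forall (v : obj L) (n : degree k), finite_set (paths_from v n).

Definition no_sources : Prop :=
  forall (v : obj L) (n : degree k), paths_from v n !=set0.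

(* The free commutative monoid on the vertices: finite multisets of vertices,
   with sum msetD and zero mset0. *)
Definition free_cmon := {mset (obj L)}%mset.

End KGraphs.

HB.instance Definition _ (K : choiceType) :=
  Monoid.isComLaw.Build {mset K}%mset mset0 (@msetD K)
    (@msetDA K) (@msetDC K) (@mset0D K).

Section Relations.
Variables (k : nat) (L : kgraph k).

Implicit Types (a b c : free_cmon L).

(* The sum of the s(l), over the l with range x and degree e_i, counted with
   multiplicity. As a finitely supported big operator it is the intended sum
   whenever that set of paths is finite. *)
Definition source_sum (i : 'I_k) (x : obj L) : free_cmon L :=
  \big[@msetD (obj L)/mset0]_(l \in paths_from x (std_gen i)) [mset src l]%mset.

(* Here c is the sum of the x_j for j <> t, and x is x_t. *)
Definition step (i : 'I_k) a b : Prop :=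
  exists (c : free_cmon L) (x : obj L),
    [/\ paths_from x (std_gen i) !=set0,
        a = msetD c [mset x]%mset & b = msetD c (source_sum i x)].

(* The relation lives on nonzero elements; the restriction only excludes the
   reflexive pair at mset0, since for row-finite L both sides of a step are
   nonzero. *)
Definition arrow a b : Prop :=
  [/\ a <> mset0, b <> mset0 &
      clos_refl_trans (free_cmon L) (fun u w => exists i, step i u w) a b].

(* The least congruence containing arrow. *)
Inductive cong : free_cmon L -> free_cmon L -> Prop :=
| cong_arrow a b : arrow a b -> cong a b
| cong_refl a : cong a a
| cong_sym a b : cong a b -> cong b a
| cong_trans a b c : cong a b -> cong b c -> cong a c
| cong_add a b c d : cong a b -> cong c d -> cong (msetD a c) (msetD b d).

End Relations.

(* Main.v *)
Require Import Defs.
From mathcomp Require Import all_boot finmap multiset.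
From mathcomp Require Import ssralg classical_sets cardinality fsbigop.
From Stdlib Require Import Relations.

(** Write [T n] for the additive endomorphism of the free commutative monoid
    that replaces every vertex [x] by the sum of the sources of the paths of
    degree [n] with range [x], and [reach] for the reflexive and transitive
    closure of the one-step rewriting relation.

    Unique factorization identifies the paths of degree [m + n] from [x] with
    the composable pairs of paths of degrees [m] and [n], so that
    [T n (T m x) = T (m + n) x]; in particular the operators [T] commute
    ([fire_all_path_sum]).  Without sources, firing the vertices of [a] one
    after the other shows that [a] reaches [T e_i a] ([reach_fire_all]).  Two
    facts follow.
    - If [a] rewrites to [b] by firing one vertex at colour [i], then firing
      the other vertices of [a] at colour [i] leads from [b] to [T e_i a]
      ([step_fire_all]).  Iterating, if [a] reaches [b] then [b] reaches
      [T_w a] for some word [w] of colours ([reach_fire_word]).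
    - If [a] reaches [c] then [T_w a] reaches [T_w c], because the operators
      commute ([reach_fire_word_homo]).

    Hence, if [a] reaches both [b] and [c], then [b] reaches [T_w a], which
    reaches [T_w c], and [c] reaches [T_w c]: the rewriting is confluent
    ([reach_confluent]).  Having a common reduct is then a transitive relation,
    so it is a congruence containing the arrows, and it contains the congruence
    they generate. *)

Set Implicit Arguments.
Unset Strict Implicit.
Unset Printing Implicit Defensive.

Import GRing.Theory.
Local Open Scope classical_set_scope.
Local Open Scope ring_scope.
Local Open Scope mset_scope.

Local Notation "\msum_ ( i <- r ) F" := (\big[msetD/mset0]_(i <- r) F)
  (at level 41, i at level 60, r at level 60, F at level 41).

Lemma perm_enum_msetD (K : choiceType) (A B : {mset K}) :
  perm_eq (A `+` B) (A ++ B : seq K).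
Proof.
apply/eq_seq_msetP; rewrite seq_mset_id; apply/msetP=> x.
by rewrite msetE2 mset_seqE count_cat !count_mem_mset.
Qed.

Lemma msum_mset1 (K : choiceType) (A : {mset K}) : \msum_(x <- A) [mset x] = A.
Proof.
rewrite -[RHS]seq_mset_id; elim: (A : seq K) => [|x s IHs].
  by rewrite big_nil; apply/msetP=> y; rewrite mset_seqE mset0E.
by rewrite big_cons mset_cons IHs.
Qed.

Lemma msetDr_neq0 (K : choiceType) (A B : {mset K}) :
  B <> mset0 -> A `+` B <> mset0.
Proof.
move=> B0 AB0; apply: B0; apply/msetP=> x.
by move/msetP/(_ x)/eqP: AB0; rewrite msetE2 !mset0E addn_eq0 => /andP[_ /eqP].
Qed.

Section Confluence.
Variables (k : nat) (L : kgraph k).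
Hypothesis rfL : row_finite L.

Implicit Types (x : obj L) (l p : mor L) (m n : degree k).
Implicit Types (a b c d : free_cmon L) (i : 'I_k) (w : seq 'I_k).

(** * Paths and the operators [T] *)

(** The paths of degree [n] with range [x], as a finite set; [fset_set] has its
    intended value because of row-finiteness. *)
Definition paths n x : {fset mor L} := fset_set (paths_from x n).

Lemma mem_paths n x l : (l \in paths n x) = (rng l == x) && (deg l == n).
Proof.
rewrite in_fset_set; last exact: rfL.
by apply/idP/andP => [/set_mem[-> ->]|[/eqP <- /eqP <-]]; rewrite ?inE ?eqxx.
Qed.

(** The sum of the sources of the paths of degree [n] with range [x], that is,
    the value of the operator [T n] on the generator [x]. *)
Definition path_sum n x : free_cmon L := \msum_(l <- paths n x) [mset src l].

Lemma source_sumE i x : source_sum i x = path_sum (std_gen i) x.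
Proof. by rewrite /source_sum fsbig_finite //; exact: rfL. Qed.

Lemma path_sum_neq0 n x : paths_from x n !=set0 -> path_sum n x <> mset0.
Proof.
move=> [l [lx ln]] /msetP/(_ (src l))/eqP.
have lP : l \in paths n x by rewrite mem_paths lx ln !eqxx.
by rewrite /path_sum (big_rem l) //= msetE2 msetnxx mset0E addn_eq0.
Qed.

(** The operator [T n]. *)
Definition fire_all n a : free_cmon L := \msum_(x <- enum_mset a) path_sum n x.

Lemma fire_all0 n : fire_all n mset0 = mset0.
Proof. by rewrite /fire_all enum_mset0 big_nil. Qed.

Lemma fire_allD n : {morph fire_all n : a b / a `+` b}.
Proof.
by move=> a b; rewrite /fire_all (perm_big _ (perm_enum_msetD a b)) big_cat.
Qed.

Lemma fire_all1 n x : fire_all n [mset x] = path_sum n x.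
Proof. by rewrite /fire_all enum_msetn big_seq1. Qed.

(** Concatenation enumerates the paths of degree [m + n] without repetition. *)
Lemma perm_paths_comp m n x :
  perm_eq [seq Defs.comp l p | l <- paths m x, p <- paths n (src l)]
          (paths (m + n) x).
Proof.
apply: uniq_perm => [||q].
- apply: allpairs_uniq_dep => [|l _|]; rewrite ?fset_uniq //.
  move=> _ _ /allpairsPdep[l [p [lP pP ->]]] /allpairsPdep[l' [p' [lP' pP' ->]]].
  rewrite /= => eq_comp.
  move: lP pP lP' pP'; rewrite !mem_paths.
  move=> /andP[_ /eqP dl] /andP[/eqP rp /eqP dp].
  move=> /andP[_ /eqP dl'] /andP[/eqP rp' /eqP dp'].
  have dlp : deg (Defs.comp l p) = m + n by rewrite deg_comp // dl dp.
  have [mu [_ mu_uniq]] := unique_factorization dlp.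
  have E : mu = (l, p) by apply: mu_uniq.
  have E' : mu = (l', p') by apply: mu_uniq.
  by move: E'; rewrite E => -[-> ->].
- exact: fset_uniq.
rewrite mem_paths; apply/allpairsPdep/andP => [[l [p []]]|[/eqP rq /eqP dq]].
  rewrite !mem_paths => /andP[/eqP rl /eqP dl] /andP[/eqP rp /eqP dp] ->.
  by rewrite rng_comp // deg_comp // rl dl dp !eqxx.
have [[l p] [[/= lp qE dl dp] _]] := unique_factorization dq.
exists l, p; rewrite !mem_paths dl dp -lp -rq qE rng_comp // !eqxx.
by split.
Qed.

Lemma fire_all_path_sum m n x : fire_all n (path_sum m x) = path_sum (m + n) x.
Proof.
rewrite [path_sum m x]/path_sum (big_morph _ (fire_allD n) (fire_all0 n)).
rewrite /path_sum -(perm_big _ (perm_paths_comp m n x)) big_allpairs_dep /=.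
apply: eq_bigr => l _; rewrite fire_all1; apply: eq_big_seq => p.
by rewrite mem_paths => /andP[/eqP rp _]; rewrite src_comp.
Qed.

(** * Reachability *)

Definition reach : relation (free_cmon L) :=
  clos_refl_trans (free_cmon L) (fun u v => exists i, step i u v).

Lemma reach_refl a : reach a a.
Proof. exact: rt_refl. Qed.

Lemma reach_trans b a c : reach a b -> reach b c -> reach a c.
Proof. exact: rt_trans. Qed.

Lemma reach_addl c a b : reach a b -> reach (c `+` a) (c `+` b).
Proof.
elim=> {a b} [a b [i [d [x [xP -> ->]]]]|a|a b d _ IH1 _ IH2].
- apply: rt_step; exists i, (c `+` d), x.
  by rewrite !msetDA.
- exact: reach_refl.
- exact: reach_trans IH1 IH2.
Qed.

Lemma reach_add a b c d : reach a b -> reach c d -> reach (a `+` c) (b `+` d).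
Proof.
move=> ab cd; apply: (@reach_trans (a `+` d)); first exact: reach_addl.
by rewrite ![_ `+` d]msetDC; apply: reach_addl.
Qed.

Lemma reach_neq0 a b : reach a b -> a <> mset0 -> b <> mset0.
Proof.
elim=> {a b} [a b [i [c [x [xP _ ->]]]] _|//|a b c _ IH1 _ IH2 a0].
  by apply: msetDr_neq0; rewrite source_sumE; apply: path_sum_neq0.
exact/IH2/IH1.
Qed.

Lemma arrow_reach a b : a <> mset0 -> reach a b -> arrow a b.
Proof. by move=> a0 ab; split=> //; apply: reach_neq0 ab a0. Qed.

(** * Confluence *)

Hypothesis nsL : no_sources L.

Lemma reach_fire_all i a : reach a (fire_all (std_gen i) a).
Proof.
rewrite -{1}[a]msum_mset1 /fire_all; apply: big_ind2 => [||x _].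
- exact: reach_refl.
- by move=> *; apply: reach_add.
apply: rt_step; exists i, mset0, x.
by rewrite !mset0D source_sumE; split=> //; apply: nsL.
Qed.

Lemma step_fire_all i a b : step i a b -> reach b (fire_all (std_gen i) a).
Proof.
move=> [c [x [_ -> ->]]]; rewrite fire_allD fire_all1 source_sumE.
by apply: reach_add; [apply: reach_fire_all | apply: reach_refl].
Qed.

Lemma reach_fire_all_homo n a b :
  reach a b -> reach (fire_all n a) (fire_all n b).
Proof.
elim=> {a b} [a b [i [c [x [_ -> ->]]]]|a|a b c _ IH1 _ IH2].
- rewrite !fire_allD fire_all1 source_sumE; apply: reach_addl.
  (* Commutation: T n (T e_i x) = T e_i (T n x). *)
  rewrite fire_all_path_sum addrC -fire_all_path_sum.
  exact: reach_fire_all.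
- exact: reach_refl.
- exact: reach_trans IH1 IH2.
Qed.

(** The composite [T_w] of the operators [T e_i] along a word [w] of colours. *)
Definition fire_word w a : free_cmon L :=
  foldr (fun i => fire_all (std_gen i)) a w.

Lemma reach_fire_word_self w a : reach a (fire_word w a).
Proof.
elim: w => [|i w IHw] /=; first exact: reach_refl.
exact: reach_trans IHw (reach_fire_all i _).
Qed.

Lemma reach_fire_word_homo w a b :
  reach a b -> reach (fire_word w a) (fire_word w b).
Proof. by move=> ab; elim: w => //= i w; apply: reach_fire_all_homo. Qed.

Lemma reach_fire_word a b : reach a b -> exists w, reach b (fire_word w a).
Proof.
elim=> {a b} [a b [i ab]|a|a b c _ [u bu] _ [v cv]].
- by exists [:: i]; apply: step_fire_all.
- by exists [::]; apply: reach_refl.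
exists (v ++ u); rewrite /fire_word foldr_cat.
exact: reach_trans cv (reach_fire_word_homo v bu).
Qed.

Lemma reach_confluent a b c :
  reach a b -> reach a c -> exists2 d, reach b d & reach c d.
Proof.
move=> /reach_fire_word[w bw] ac; exists (fire_word w c).
  exact: reach_trans bw (reach_fire_word_homo w ac).
exact: reach_fire_word_self.
Qed.

Lemma cong_joinable a b : cong a b -> exists2 c, reach a c & reach b c.
Proof.
elim=> {a b} [a b [_ _ ab]|a|a b _ [c ac bc]||].
- by exists b => //; apply: reach_refl.
- by exists a; apply: reach_refl.
- by exists c.
- move=> a b c _ [d ad bd] _ [e be ce].
  have [f df ef] := reach_confluent bd be.
  by exists f; [apply: reach_trans ad df | apply: reach_trans ce ef].
- move=> a b c d _ [e ae be] _ [f cf df].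
  by exists (e `+` f); apply: reach_add.
Qed.

End Confluence.

Theorem lemma3p5 (k : nat) (k_ge1 : (1 <= k)%N) (L : kgraph k)
    (rfL : row_finite L) (nsL : no_sources L)
    (alpha beta : free_cmon L)
    (alpha0 : alpha <> mset0) (beta0 : beta <> mset0) :
  cong alpha beta <->
  exists gamma : free_cmon L,
    [/\ gamma <> mset0, arrow alpha gamma & arrow beta gamma].
Proof.
split=> [/(cong_joinable rfL nsL)[gamma ag bg]|[gamma [_ ag bg]]].
  exists gamma; split; [exact: reach_neq0 ag alpha0 | |]; exact: arrow_reach.
by apply: cong_trans (cong_arrow ag) (cong_sym (cong_arrow bg)).
Qed.
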